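(* Let $k$ be a field of characteristic zero and let $\mathfrak{m}_0$ be the Lie algebra over $k$ with basis $e_i$, $i\geq 1$, whose only nonzero brackets (up to skew-symmetry) are $[e_1,e_i]=e_{i+1}$ for $i\geq 2$. The graded Lie algebra $H^1(\mathfrak{m}_0,\mathfrak{m}_0)=\bigoplus_{l\in\mathbb{Z}}H^1_l(\mathfrak{m}_0,\mathfrak{m}_0)$ is generated as a vector space by the classes of $\omega_1,\omega_2$ in weight $0$, $\gamma$ in weight $1$, and $\alpha_l$ in weight $l$ for each $l\geq 2$ (defined in the context), and its bracket is described as follows: the commuting weight zero generators $\omega_1,\omega_2$ act as grading elements on the abelian Lie algebra generated by $\gamma$ and the $\alpha_l$, $l\geq 2$; $\gamma$ has degree $-1$ with respect to $\omega_1$ and degree $1$ with respect to $\omega_2$; $\alpha_l$ has degree $l$ with respect to $\omega_1$ and degree $0$ with respect to $\omega_2$. That is, in cohomology, for all $l,m\geq 2$: $$[\omega_1,\omega_2]=0,\quad [\omega_1,\gamma]=-\gamma,\quad [\omega_2,\gamma]=\gamma,\quad [\omega_1,\alpha_l]=l\,\alpha_l,\quad [\omega_2,\alpha_l]=0,\quad [\alpha_l,\gamma]=0,\quad [\alpha_l,\alpha_m]=0.$$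
   Context: For $l\in\mathbb{Z}$, $H^1_l(\mathfrak{m}_0,\mathfrak{m}_0)$ is the quotient of the space of derivations $\omega$ of the form $\omega(e_i)=a_ie_{i+l}$ for all $i\ge1$ (with $e_s:=0$ for $s\le 0$) by the subspace of those that are inner. The bracket on $H^1$ is induced by the commutator of derivations, $[a,b](x)=a(b(x))-b(a(x))$. The generators are the derivations: - $\omega_1(e_1)=e_1$, $\omega_1(e_2)=0$, $\omega_1(e_k)=(k-2)e_k$ for $k\geq 3$; - $\omega_2(e_1)=0$, $\omega_2(e_k)=e_k$ for $k\geq 2$; - $\gamma(e_1)=c\,e_2$, $\gamma(e_k)=0$ for $k\geq 2$, where $c$ is a fixed nonzero scalar; - for $l\geq 2$: $\alpha_l(e_1)=0$, $\alpha_l(e_k)=b_l\,e_{k+l}$ for $k\geq 2$, where $b_l$ is a fixed nonzero scalar. *)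

(* Defs.v *)
From HB Require Import structures.
From mathcomp Require Import all_boot all_order all_algebra.
From mathcomp Require Import finmap boolp classical_sets functions cardinality.
From mathcomp Require Import fsbigop.
From mathcomp Require Import monalg.

Set Implicit Arguments.
Unset Strict Implicit.
Unset Printing Implicit Defensive.

Import GRing.Theory Num.Theory.
Local Open Scope ring_scope.
Local Open Scope quotient_scope.

(* [m0 k] is the free vector space on [nat]; the generator of index [n] plays *)
(* the role of e_(n+1), so that [e] below is indexed as usual from 1, with    *)
(* e_s = 0 for s <= 0.                                                        *)
Notation m0 k := {malg k[nat]}.

Definition e {k : fieldType} (s : int) : m0 k :=
  if s is Posz n.+1 then << n >> else 0.
Arguments e : simpl never.

Section LinearExtension.
Variable k : fieldType.

(* the linear endomorphism of m0 with e_i |-> f i for all i >= 1 ([lext_e]);  *)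
(* the value f 0 is irrelevant                                                *)
Definition lext (f : nat -> m0 k) (x : m0 k) : m0 k :=
  \sum_(n <- msupp x) x@_n *: f n.+1.

Lemma lextEw f (x : m0 k) (d : {fset nat}) : (msupp x `<=` d)%fset ->
  lext f x = \sum_(n <- d) x@_n *: f n.+1.
Proof.
move=> sxd; rewrite /lext (big_fset_incl _ sxd) //= => n _ nx.
by rewrite mcoeff_outdom // scale0r.
Qed.

Lemma lext_linear f : linear (lext f).
Proof.
move=> a x y; pose d := (msupp x `|` msupp y `|` msupp (a *: x + y))%fset.
have sub z : z \in [:: x; y; a *: x + y] -> lext f z = \sum_(n <- d) z@_n *: f n.+1.
  move=> zin; apply: lextEw; apply/fsubsetP => n; rewrite !inE.
  by move: zin; rewrite !inE => /or3P[] /eqP-> ->; rewrite ?orbT.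
rewrite !sub ?inE ?eqxx ?orbT // scaler_sumr -big_split /=.
by apply: eq_bigr => n _; rewrite mcoeffD mcoeffZ scalerDl scalerA.
Qed.

Lemma lext_e f (i : nat) : (0 < i)%N -> lext f (e i) = f i.
Proof.
case: i => // i _; rewrite (@lextEw _ _ [fset i]%fset) ?msuppU_le //=.
by rewrite big_seq_fset1 mcoeffUU scale1r.
Qed.

End LinearExtension.

Section LinearFun.
Variables (k : fieldType) (f : m0 k -> m0 k).
Hypothesis lf : linear f.

Lemma linD x y : f (x + y) = f x + f y.
Proof. by have := lf 1 x y; rewrite !scale1r. Qed.
Lemma lin0 : f 0 = 0.
Proof. by apply: (addrI (f 0)); rewrite -linD !addr0. Qed.
Lemma linZ a x : f (a *: x) = a *: f x.
Proof. by have := lf a x 0; rewrite !addr0 lin0 addr0. Qed.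
Lemma linN x : f (- x) = - f x.
Proof. by rewrite -scaleN1r linZ scaleN1r. Qed.

Lemma linE x : f x = lext (fun i => f (e i)) x.
Proof.
have fsum (r : seq nat) (F : nat -> m0 k) :
    f (\sum_(n <- r) F n) = \sum_(n <- r) f (F n).
  elim: r => [|n r IH]; first by rewrite !big_nil lin0.
  by rewrite !big_cons linD IH.
rewrite {1}[x]monalgE fsum; apply: eq_bigr => n _.
rewrite -linZ; congr f; apply/eqP/eqP/malgP => j.
by rewrite mcoeffZ !mcoeffU; case: eqP => _; rewrite ?mulr1 ?mulr0.
Qed.

End LinearFun.

Lemma lin_ext (k : fieldType) (f g : m0 k -> m0 k) : linear f -> linear g ->
  (forall i : nat, (0 < i)%N -> f (e i) = g (e i)) -> f = g.
Proof.
move=> lf lg fg; apply/funext => x; rewrite (linE lf) (linE lg).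
by apply: eq_bigr => n _; rewrite fg.
Qed.

Section Bracket.
Variable k : fieldType.

(* [e_i, e_j] for i, j >= 1 *)
Definition br_basis (i j : nat) : m0 k :=
  if (i == 1%N) && (2 <= j)%N then e j.+1
  else if (2 <= i)%N && (j == 1%N) then - e i.+1
  else 0.

(* the bilinear extension of [br_basis]; see [br_anti] and [br_jacobi] for the *)
(* Lie algebra axioms                                                          *)
Definition br (x y : m0 k) : m0 k :=
  lext (fun i => lext (fun j => br_basis i j) y) x.

Lemma br_e (i j : nat) : (0 < i)%N -> (0 < j)%N ->
  br (e i) (e j) = br_basis i j.
Proof. by move=> i0 j0; rewrite /br !lext_e. Qed.

Lemma br_linear_l y : linear (br^~ y).
Proof. exact: lext_linear. Qed.

Lemma br_linear_r x : linear (br x).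
Proof.
move=> a y z; rewrite /br /lext scaler_sumr -big_split /=.
apply: eq_bigr => n _; rewrite -![\sum_(_ <- msupp _) _]/(lext _ _).
by rewrite lext_linear scalerDr !scalerA mulrC.
Qed.

Definition derivation (f : m0 k -> m0 k) : Prop :=
  linear f /\ forall x y, f (br x y) = br (f x) y + br x (f y).

Definition homogeneous (l : int) (f : m0 k -> m0 k) : Prop :=
  exists a : nat -> k, forall i : nat, (0 < i)%N ->
    f (e i) = a i *: e (i%:Z + l).

Definition inner (f : m0 k -> m0 k) : Prop := exists x, f = br x.

Definition der (l : int) : {pred (m0 k -> m0 k)} :=
  fun f => `[< derivation f /\ homogeneous l f >].

Lemma derP l f : reflect (derivation f /\ homogeneous l f) (f \in der l).
Proof. exact: asboolP. Qed.

Lemma der_submod_closed l : submod_closed (der l).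
Proof.
split=> [|c f g /derP[[lf df] [a fa]] /derP[[lg dg] [b gb]]]; apply/derP.
  split; last by exists (fun=> 0) => i _; rewrite scale0r.
  split=> [c x y|x y]; first by rewrite /= scaler0 addr0.
  by rewrite (lin0 (br_linear_l y)) (lin0 (br_linear_r x)) addr0.
have E x : (c *: f + g) x = c *: f x + g x by [].
split; last first.
  by exists (fun i => c * a i + b i) => i i0; rewrite E fa // gb // scalerDl scalerA.
split=> [d x y|x y]; rewrite !E.
  rewrite lf lg !scalerDr !scalerA (mulrC c d) -!addrA; congr (_ + _).
  by rewrite addrCA.
rewrite df dg (br_linear_l y) (br_linear_r x) scalerDr -!addrA.
by congr (_ + _); rewrite addrCA.
Qed.

HB.instance Definition _ l := GRing.isSubmodClosed.Build k _ (der l)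
  (GRing.submod_closed_semi (der_submod_closed l)).

(* [Der l] is the space of derivations of the form e_i |-> a_i e_(i+l);       *)
(* [Hl l] below is its quotient by the inner ones                             *)
Record Der (l : int) := MkDer { der_fun :> m0 k -> m0 k; derW : der_fun \in der l }.
HB.instance Definition _ l := [isSub for @der_fun l].
HB.instance Definition _ l := [Choice of Der l by <:].
HB.instance Definition _ l := [SubChoice_isSubLmodule of Der l by <:].

Definition inn (l : int) : {pred Der l} := fun d => `[< inner d >].
Arguments inn l : clear implicits.

Lemma innP l (d : Der l) : reflect (inner d) (d \in inn l).
Proof. exact: asboolP. Qed.

Lemma inn_submod_closed l : submod_closed (inn l).
Proof.
split=> [|c d d' /innP[x dx] /innP[y dy]]; apply/innP.
  by exists 0; apply/funext => y; rewrite (lin0 (br_linear_l y)).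
exists (c *: x + y); apply/funext => z.
by rewrite (br_linear_l z) -dx -dy.
Qed.

HB.instance Definition _ l := GRing.isSubmodClosed.Build k _ (inn l)
  (GRing.submod_closed_semi (inn_submod_closed l)).

Definition Hl (l : int) : Type := Quotient.quot (inn l).
HB.instance Definition _ l := GRing.Zmodule.on (Hl l).
HB.instance Definition _ l := EqQuotient.on (Hl l).

Definition cls l (d : Der l) : Hl l := \pi_(Hl l) d.

Lemma cls_eqP l (d d' : Der l) : reflect (cls d = cls d') (d - d' \in inn l).
Proof. by rewrite Quotient.idealrBE; exact: eqP. Qed.

Lemma cls_surj l (x : Hl l) : {d | x = cls d}.
Proof. by exists (repr x); rewrite /cls reprK. Qed.

Lemma clsD l : {morph @cls l : d d' / d + d'}.
Proof. exact: raddfD. Qed.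

Definition Hl_scale l (c : k) (x : Hl l) : Hl l := cls (c *: repr x).

Lemma Hl_scaleE l c (d : Der l) : Hl_scale c (cls d) = cls (c *: d).
Proof.
apply/cls_eqP; rewrite -scalerBr rpredZ //.
by apply/cls_eqP; rewrite /cls reprK.
Qed.

Fact Hl_scaleA l a b (x : Hl l) :
  Hl_scale a (Hl_scale b x) = Hl_scale (a * b) x.
Proof. by have [d ->] := cls_surj x; rewrite !Hl_scaleE scalerA. Qed.
Fact Hl_scale1 l : left_id 1 (@Hl_scale l).
Proof. by move=> x; have [d ->] := cls_surj x; rewrite Hl_scaleE scale1r. Qed.
Fact Hl_scaleDr l : right_distributive (@Hl_scale l) +%R.
Proof.
move=> a x y; have [d ->] := cls_surj x; have [d' ->] := cls_surj y.
by rewrite -clsD !Hl_scaleE scalerDr clsD.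
Qed.
Fact Hl_scaleDl l (x : Hl l) : {morph (@Hl_scale l)^~ x : a b / a + b}.
Proof.
move=> a b; have [d ->] := cls_surj x.
by rewrite !Hl_scaleE scalerDl clsD.
Qed.
HB.instance Definition _ l := GRing.Zmodule_isLmodule.Build k (Hl l)
  (@Hl_scaleA l) (@Hl_scale1 l) (@Hl_scaleDr l) (@Hl_scaleDl l).

Lemma clsZ l c (d : Der l) : cls (c *: d) = c *: cls d.
Proof. by rewrite -Hl_scaleE. Qed.

Lemma comm_der (l m n : int) (lmn : l + m = n) (a : Der l) (b : Der m) :
  (fun x => a (b x) - b (a x)) \in der n.
Proof.
have /derP[[la da] [ca ea]] := derW a; have /derP[[lb db] [cb eb]] := derW b.
have shuffle (V : zmodType) (p q r s p' s' : V) :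
    (p + r) + (q + s) - ((p' + q) + (r + s')) = (p - p') + (s - s').
  have T (t u v w : V) : (t + v) + (u + w) = (t + w) + (u + v).
    by rewrite (addrC u) addrACA (addrC v).
  rewrite T (T p' r q s') (addrC r q) opprD addrACA subrr addr0.
  by rewrite opprD addrACA.
apply/derP; split; first split.
- move=> c x y; rewrite [b (c *: x + y)]lb [a (c *: x + y)]la.
  by rewrite [a (c *: _ + _)]la [b (c *: _ + _)]lb scalerBr opprD addrACA.
- move=> x y; rewrite [a (br x y)]da [b (br x y)]db.
  rewrite [a (_ + _)](linD la) [b (_ + _)](linD lb).
  rewrite [a (br (b x) y)]da [a (br x (b y))]da.
  rewrite [b (br (a x) y)]db [b (br x (a y))]db.
  rewrite [br (_ - _) y](linD (br_linear_l y)) [br (- _) y](linN (br_linear_l y)).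
  rewrite [br x (_ - _)](linD (br_linear_r x)) [br x (- _)](linN (br_linear_r x)).
  exact: shuffle.
have half (l1 m1 : int) (f g : m0 k -> m0 k) (u v : nat -> k) :
    linear f -> l1 + m1 = n ->
    (forall i : nat, (0 < i)%N -> f (e i) = u i *: e (i%:Z + l1)) ->
    (forall i : nat, (0 < i)%N -> g (e i) = v i *: e (i%:Z + m1)) ->
    exists c : nat -> k, forall i : nat, (0 < i)%N ->
      f (g (e i)) = c i *: e (i%:Z + n).
  move=> lf <- fe ge.
  exists (fun i => if (i%:Z + m1) is Posz j.+1 then v i * u j.+1 else 0) => i i0.
  rewrite ge // (linZ lf) [l1 + _]addrC addrA.
  case: (i%:Z + m1) => [[|j]|j].
  - by rewrite scale0r [e 0](_ : _ = 0) // (lin0 lf) scaler0.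
  - by rewrite fe // scalerA.
  - by rewrite scale0r [e (Negz j)](_ : _ = 0) // (lin0 lf) scaler0.
have [c Ec] := half l m a b ca cb la lmn ea eb.
have [c' Ec'] := half m l b a cb ca lb (etrans (addrC m l) lmn) eb ea.
by exists (fun i => c i - c' i) => i i0; rewrite Ec // Ec' // scalerBl.
Qed.

Lemma DerDE l (u v : Der l) x : (u + v) x = u x + v x.
Proof. by rewrite -[der_fun (u + v)]/(\val (u + v)) raddfD. Qed.

Lemma DerBE l (u v : Der l) x : (u - v) x = u x - v x.
Proof. by rewrite -[der_fun (u - v)]/(\val (u - v)) raddfB. Qed.

(* [a, b] = a o b - b o a *)
Definition comm (l m n : int) (lmn : l + m = n) (a : Der l) (b : Der m) : Der n :=
  MkDer (comm_der lmn a b).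

Lemma comm_inn_l (l m n : int) (lmn : l + m = n) (a : Der l) (b : Der m) :
  a \in inn l -> comm lmn a b \in inn n.
Proof.
move=> /innP[x ax]; apply/innP; exists (- b x); apply/funext => y /=.
have /derP[[lb db] _] := derW b.
rewrite ax [b (br x y)]db [br (- _) y](linN (br_linear_l y)).
by rewrite opprD addrCA subrr addr0.
Qed.

Lemma comm_inn_r (l m n : int) (lmn : l + m = n) (a : Der l) (b : Der m) :
  b \in inn m -> comm lmn a b \in inn n.
Proof.
move=> /innP[x bx]; apply/innP; exists (a x); apply/funext => y /=.
have /derP[[la da] _] := derW a.
by rewrite bx [a (br x y)]da addrK.
Qed.

(* induced by the commutator of derivations, see [Hl_brE]; the equation       *)
(* l + m = n spares a cast between Hl (l + m) and Hl n                        *)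
Definition Hl_br (l m n : int) (lmn : l + m = n) (x : Hl l) (y : Hl m) : Hl n :=
  cls (comm lmn (repr x) (repr y)).

Lemma Hl_brE (l m n : int) (lmn : l + m = n) (a : Der l) (b : Der m) :
  Hl_br lmn (cls a) (cls b) = cls (comm lmn a b).
Proof.
have ra : repr (cls a) - a \in inn l by apply/cls_eqP; rewrite /cls reprK.
have rb : repr (cls b) - b \in inn m by apply/cls_eqP; rewrite /cls reprK.
apply/cls_eqP; move: (repr (cls a)) (repr (cls b)) ra rb => a' b' ra rb.
rewrite [_ - _](_ : _ = comm lmn (a' - a) b' + comm lmn a (b' - b)).
  by apply: rpredD; [apply: comm_inn_l|apply: comm_inn_r].
apply/val_inj/funext => x /=.
have /derP[[la _] _] := derW a; have /derP[[lb' _] _] := derW b'.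
rewrite -[LHS]/((comm lmn a' b' - comm lmn a b) x) DerBE.
rewrite -[RHS]/((comm lmn (a' - a) b' + comm lmn a (b' - b)) x) DerDE.
have commE a1 b1 : comm lmn a1 b1 x = a1 (b1 x) - b1 (a1 x) by [].
rewrite !commE !DerBE.
rewrite [b' (_ - _)](linD lb') [b' (- _)](linN lb').
rewrite [a (_ - _)](linD la) [a (- _)](linN la).
set p := a (b' x); set q := b' (a x).
rewrite !opprD !opprK -!addrA; congr (_ + _).
by rewrite (addrCA q p) (addrCA _ p) addKr; congr (_ + _); rewrite addrCA addNKr.
Qed.

Definition Hfam : Type := forall l : int, Hl l.
HB.instance Definition _ := Choice.on Hfam.

Fact Hfam_addA : associative (fun (x y : Hfam) l => x l + y l).
Proof. by move=> x y z; apply/functional_extensionality_dep => l; rewrite addrA. Qed.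
Fact Hfam_addC : commutative (fun (x y : Hfam) l => x l + y l).
Proof. by move=> x y; apply/functional_extensionality_dep => l; rewrite addrC. Qed.
Fact Hfam_add0 : left_id (fun l => 0) (fun (x y : Hfam) l => x l + y l).
Proof. by move=> x; apply/functional_extensionality_dep => l; rewrite add0r. Qed.
Fact Hfam_addN :
  left_inverse (fun l => 0) (fun (x : Hfam) l => - x l) (fun (x y : Hfam) l => x l + y l).
Proof. by move=> x; apply/functional_extensionality_dep => l; rewrite addNr. Qed.
HB.instance Definition _ :=
  GRing.isZmodule.Build Hfam Hfam_addA Hfam_addC Hfam_add0 Hfam_addN.

Definition Hfam_scale (c : k) (x : Hfam) : Hfam := fun l => c *: x l.
Fact Hfam_scaleA a b x : Hfam_scale a (Hfam_scale b x) = Hfam_scale (a * b) x.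
Proof. by apply/functional_extensionality_dep => l; rewrite /Hfam_scale scalerA. Qed.
Fact Hfam_scale1 : left_id 1 Hfam_scale.
Proof. by move=> x; apply/functional_extensionality_dep => l; rewrite /Hfam_scale scale1r. Qed.
Fact Hfam_scaleDr : right_distributive Hfam_scale +%R.
Proof. by move=> a x y; apply/functional_extensionality_dep => l; exact: scalerDr. Qed.
Fact Hfam_scaleDl x : {morph Hfam_scale^~ x : a b / a + b}.
Proof. by move=> a b; apply/functional_extensionality_dep => l; exact: scalerDl. Qed.
HB.instance Definition _ := GRing.Zmodule_isLmodule.Build k Hfam
  Hfam_scaleA Hfam_scale1 Hfam_scaleDr Hfam_scaleDl.

Definition supp (x : Hfam) : set int := [set l | x l <> 0].

Definition fsupp : {pred Hfam} := fun x => `[< finite_set (supp x) >].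

Lemma fsuppP x : reflect (finite_set (supp x)) (x \in fsupp).
Proof. exact: asboolP. Qed.

Lemma fsupp_submod_closed : submod_closed fsupp.
Proof.
split=> [|c x y /fsuppP fx /fsuppP fy]; apply/fsuppP.
  by apply: (sub_finite_set _ (@finite_set0 int)) => l /(_ erefl).
have fxy : finite_set (supp x `|` supp y)%classic by rewrite finite_setU.
apply: (sub_finite_set _ fxy) => l; rewrite /supp /= => xyl.
apply: contrapT => /not_orP[/contrapT xl /contrapT yl]; apply: xyl.
by rewrite -[LHS]/(c *: x l + y l) xl yl scaler0 addr0.
Qed.

HB.instance Definition _ := GRing.isSubmodClosed.Build k _ fsupp
  (GRing.submod_closed_semi fsupp_submod_closed).

(* the direct sum of all [Hl l] *)
Record H1 := MkH1 { H1_fun : Hfam; H1W : H1_fun \in fsupp }.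
HB.instance Definition _ := [isSub for H1_fun].
HB.instance Definition _ := [Choice of H1 by <:].
HB.instance Definition _ := [SubChoice_isSubLmodule of H1 by <:].

Definition component (x : H1) (l : int) : Hl l := H1_fun x l.
Coercion component : H1 >-> Funclass.

Definition single_fam (l : int) (x : Hl l) : Hfam :=
  fun m => if l =P m is ReflectT lm then ecast n (Hl n) lm x else 0.

Lemma single_famE l (x : Hl l) : single_fam x l = x.
Proof.
by rewrite /single_fam; case: eqP => // ll; rewrite (eq_irrelevance ll erefl).
Qed.

Lemma single_fam0 l m (x : Hl l) : l != m -> single_fam x m = 0.
Proof. by rewrite /single_fam; case: eqP. Qed.

Fact single_fsupp l (x : Hl l) : single_fam x \in fsupp.
Proof.
apply/fsuppP; apply: (sub_finite_set _ (finite_set1 l)) => m /= xm.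
by apply/esym/eqP; apply: contrapT => /negP lm; apply: xm; rewrite single_fam0.
Qed.

(* the inclusion of the weight l summand *)
Definition single l (x : Hl l) : H1 := MkH1 (single_fsupp x).

Lemma Hl_br0l (l m n : int) (lmn : l + m = n) (y : Hl m) : Hl_br lmn 0 y = 0.
Proof.
have [b ->] := cls_surj y; rewrite -(raddf0 (@cls l)) Hl_brE.
rewrite -(raddf0 (@cls n)); apply/cls_eqP; rewrite subr0.
by apply: comm_inn_l; exact: rpred0.
Qed.

Lemma Hl_br0r (l m n : int) (lmn : l + m = n) (x : Hl l) : Hl_br lmn x 0 = 0.
Proof.
have [a ->] := cls_surj x; rewrite -(raddf0 (@cls m)) Hl_brE.
rewrite -(raddf0 (@cls n)); apply/cls_eqP; rewrite subr0.
by apply: comm_inn_r; exact: rpred0.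
Qed.

(* the weight n component of [x, y] is \sum_l [x_l, y_(n-l)]; only finitely *)
(* many terms are nonzero                                                    *)
Definition H1_br_fam (x y : H1) : Hfam := fun n =>
  \sum_(l \in [set: int]%classic) Hl_br (subrKC l n) (x l) (y (n - l)).

Fact H1_br_fsupp x y : H1_br_fam x y \in fsupp.
Proof.
have /fsuppP fx := H1W x; have /fsuppP fy := H1W y.
apply/fsuppP; apply: (sub_finite_set _ (finite_image2 +%R fx fy)) => n /= xyn.
apply: contrapT => nxy; apply: xyn; apply: fsbig1 => l _.
have [->|/eqP xl] := eqVneq (x l) 0; first exact: Hl_br0l.
have [->|/eqP yl] := eqVneq (y (n - l)) 0; first exact: Hl_br0r.
by case: nxy; exists l => //; exists (n - l) => //; rewrite subrKC.
Qed.

Definition H1_br (x y : H1) : H1 := MkH1 (H1_br_fsupp x y).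

Lemma derivation_basis f : linear f ->
  (forall i j : nat, (0 < i)%N -> (0 < j)%N ->
    f (br (e i) (e j)) = br (f (e i)) (e j) + br (e i) (f (e j))) ->
  derivation f.
Proof.
move=> lf fb; split=> // x y.
pose F (y x : m0 k) := f (br x y).
pose G (y x : m0 k) := br (f x) y + br x (f y).
have lF y' : linear (F y').
  by move=> c u v; rewrite /F [br _ y']br_linear_l lf.
have lG y' : linear (G y').
  move=> c u v; rewrite /G lf [br (_ + f v) y']br_linear_l [br _ (f y')]br_linear_l.
  by rewrite scalerDr addrACA.
have lF' x' : linear (F^~ x').
  by move=> c u v; rewrite /F [br x' _]br_linear_r lf.
have lG' x' : linear (G^~ x').
  move=> c u v; rewrite /G lf [br (f x') _]br_linear_r [br x' (_ + f v)]br_linear_r.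
  by rewrite scalerDr addrACA.
rewrite -[LHS]/(F y x) -[RHS]/(G y x); congr (_ x); apply: lin_ext => // i i0.
have /(congr1 (@^~ y)) := lin_ext (lF' (e i)) (lG' (e i)) (fun j j0 => fb i j i0 j0).
by [].
Qed.

Lemma br_anti x y : br y x = - br x y.
Proof.
have lN f : linear f -> linear (fun z : m0 k => - f z).
  by move=> lf c u v; rewrite lf opprD scalerN.
have Ei i : (0 < i)%N -> br^~ (e i) = (fun z => - br (e i) z).
  move=> i0; apply: lin_ext; [exact: br_linear_l|exact/lN/br_linear_r|].
  move=> j j0; rewrite !br_e // /br_basis.
  by case: i j i0 j0 => [|[|i]] [|[|j]] //=; rewrite ?oppr0 ?opprK.
suff /(congr1 (@^~ x)) : br y = (fun z => - br z y) by [].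
apply: lin_ext; [exact: br_linear_r|exact/lN/br_linear_l|] => i i0.
exact: (congr1 (@^~ y) (Ei i i0)).
Qed.

Lemma lext_derivation (f : nat -> m0 k) :
  (forall j, (2 <= j)%N -> f j.+1 = br (f 1%N) (e j) + br (e 1%N) (f j)) ->
  (forall i j, (2 <= i)%N -> (2 <= j)%N -> br (f i) (e j) + br (e i) (f j) = 0) ->
  derivation (lext f).
Proof.
move=> f1 f2; apply: derivation_basis; first exact: lext_linear.
move=> i j i0 j0; rewrite br_e // !lext_e // /br_basis.
have lf := lext_linear f.
case: i j i0 j0 => [|[|i]] [|[|j]] //= _ _.
- by rewrite (lin0 lf) [br (e 1%N) _]br_anti subrr.
- by rewrite lext_e // f1.
- by rewrite (linN lf) lext_e // f1 // opprD -!br_anti addrC.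
- by rewrite (lin0 lf) f2.
Qed.

Lemma br_e1 (j : nat) : (2 <= j)%N -> br (e 1%N) (e j) = e j.+1.
Proof. by move=> j2; rewrite br_e ?(ltnW j2) // /br_basis j2. Qed.

Lemma br_e2 (i j : nat) : (2 <= i)%N -> (2 <= j)%N -> br (e i) (e j) = 0.
Proof.
by move=> i2 j2; rewrite br_e ?(ltnW i2) ?(ltnW j2) // /br_basis; move: i j i2 j2 => [|[|i]] [|[|j]].
Qed.

Lemma br_jacobi x : derivation (br x).
Proof.
apply: derivation_basis; first exact: br_linear_r.
move=> i j i0 j0.
have ll y := br_linear_l y; have lr y := br_linear_r y.
suff /(congr1 (@^~ x)) : br^~ (br (e i) (e j)) =
    fun x => br (br x (e i)) (e j) + br (e i) (br x (e j)) by [].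
apply: lin_ext; first exact: br_linear_l.
  move=> c u v.
  rewrite (ll (e i) c u v) (ll (e j) c u v) (ll (e j)) (lr (e i)).
  by rewrite scalerDr addrACA.
move=> h h0; case: i j h i0 j0 h0 => [|[|i]] [|[|j]] [|[|h]] // _ _ _;
  repeat first [ rewrite br_e // /br_basis /= | rewrite (linN (ll _))
    | rewrite (linN (lr _)) | rewrite (lin0 (ll _)) | rewrite (lin0 (lr _)) ];
  by rewrite ?(addr0, add0r, subrr, addNr, oppr0).
Qed.

(* In the natural number i - 2 the subtraction is truncated, but it is only   *)
(* used for i >= 2; at i = 2 it gives omega1 (e_2) = 0.                       *)
Definition omega1_fun : m0 k -> m0 k :=
  lext (fun i => if i == 1%N then e i else (i - 2)%:R *: e i).
Definition omega2_fun : m0 k -> m0 k :=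
  lext (fun i => if i == 1%N then 0 else e i).
Definition gamma_fun (c : k) : m0 k -> m0 k :=
  lext (fun i => if i == 1%N then c *: e 2%N else 0).
Definition alpha_fun (b : k) (l : nat) : m0 k -> m0 k :=
  lext (fun i => if i == 1%N then 0 else b *: e (i + l)%N).

Lemma omega1_der : omega1_fun \in der 0.
Proof.
apply/derP; split; last first.
  exists (fun i => if i == 1%N then 1 else (i - 2)%:R) => i i0.
  by rewrite /omega1_fun lext_e // addr0; case: eqP => // _; rewrite scale1r.
apply: lext_derivation => [[|[|j]] // j2|[|[|i]] [|[|j]] // i2 j2] /=.
  rewrite (linZ (br_linear_r _)) br_e1 //.
  by rewrite -[X in X + _]scale1r -scalerDl nat1r !subSS !subn0.
rewrite (linZ (br_linear_r _)) [br (_ *: _) _](linZ (br_linear_l _)).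
by rewrite br_e2 // !scaler0 addr0.
Qed.

Lemma omega2_der : omega2_fun \in der 0.
Proof.
apply/derP; split; last first.
  exists (fun i => if i == 1%N then 0 else 1) => i i0.
  rewrite /omega2_fun lext_e // addr0; case: eqP => // _.
  - by rewrite scale0r.
  - by rewrite scale1r.
apply: lext_derivation => [[|[|j]] // j2|[|[|i]] [|[|j]] // i2 j2] /=.
  by rewrite (lin0 (br_linear_l _)) add0r br_e1.
by rewrite br_e2 // addr0.
Qed.

Lemma gamma_der c : gamma_fun c \in der 1.
Proof.
apply/derP; split; last first.
  exists (fun i => if i == 1%N then c else 0) => i i0.
  by rewrite /gamma_fun lext_e //; case: eqP => [->|_] //; rewrite scale0r.
apply: lext_derivation => [[|[|j]] // j2|[|[|i]] [|[|j]] // i2 j2] /=.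
  rewrite (lin0 (br_linear_r _)) addr0.
  by rewrite [br (_ *: _) _](linZ (br_linear_l _)) br_e2 // scaler0.
by rewrite (lin0 (br_linear_r _)) (lin0 (br_linear_l _)) addr0.
Qed.

Lemma alpha_der b (l : nat) : alpha_fun b l \in der l.
Proof.
apply/derP; split; last first.
  exists (fun i => if i == 1%N then 0 else b) => i i0.
  by rewrite /alpha_fun lext_e // PoszD; case: eqP => // _; rewrite scale0r.
apply: lext_derivation => [[|[|j]] // j2|[|[|i]] [|[|j]] // i2 j2] /=.
  rewrite (lin0 (br_linear_l _)) add0r.
  by rewrite (linZ (br_linear_r _)) br_e1 // addSn.
rewrite (linZ (br_linear_r _)) [br (_ *: _) _](linZ (br_linear_l _)).
by rewrite !br_e2 // !scaler0 addr0.
Qed.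

Definition omega1 : Der 0 := MkDer omega1_der.
Definition omega2 : Der 0 := MkDer omega2_der.
Definition gamma (c : k) : Der 1 := MkDer (gamma_der c).
Definition alpha (b : k) (l : nat) : Der l := MkDer (alpha_der b l).

Definition H1_class (l : int) (d : Der l) : H1 := single (cls d).

Lemma H1_brE (l m n : int) (lmn : l + m = n) (a : Der l) (b : Der m) :
  H1_br (H1_class a) (H1_class b) = H1_class (comm lmn a b).
Proof.
apply/val_inj/functional_extensionality_dep => r /=; rewrite /H1_br_fam.
have z (i : int) : i != l ->
    Hl_br (subrKC i r) (single_fam (cls a) i) (single_fam (cls b) (r - i)) = 0.
  by move=> il; rewrite single_fam0 1?eq_sym // Hl_br0l.
rewrite -(fsbig_widen [set l]%classic) //; last first.
  by move=> i [_ /= /eqP]; exact: z.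
rewrite fsbig_set1.
rewrite /component /= single_famE; have [E|nr] := eqVneq n r.
  subst r; have mE : m = n - l by rewrite -lmn addrAC subrr add0r.
  move: (subrKC l n); rewrite -mE => E.
  by rewrite !single_famE Hl_brE (eq_irrelevance E lmn).
rewrite (@single_fam0 m) ?Hl_br0r ?single_fam0 //.
by apply: contraNneq nr => mE; rewrite -lmn mE subrKC.
Qed.

End Bracket.

Arguments omega1 {k}.
Arguments omega2 {k}.

(* Main.v *)
Require Import Defs.
From mathcomp Require Import all_boot all_order all_algebra.
From mathcomp Require Import finmap boolp classical_sets cardinality.
From mathcomp Require Import monalg zify.

Set Implicit Arguments.
Unset Strict Implicit.
Unset Printing Implicit Defensive.

Import GRing.Theory.
Local Open Scope ring_scope.

(* Since e_1 and e_2 generate m_0, a derivation is determined by its values   *)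
(* on e_1 and e_2. A homogeneous derivation is therefore given by two scalars *)
(* a_1 and a_2; a suitable combination of the generators and of an inner      *)
(* derivation ad e_j has the same two values, and in negative weight both     *)
(* vanish. The bracket relations are checked on e_1 and e_2 in the same way,  *)
(* the only one that needs an inner correction being [alpha_l, gamma].        *)

(** A derivation of weight l takes values a_1 e_(1+l) and a_2 e_(2+l) on the generators e_1 and e_2,
    so each weight leaves at most two parameters. In weight 0 both survive, as omega1 and omega2. In
    weight 1, ad e_1 absorbs a_2 and gamma remains; in weight l >= 2, ad e_l absorbs a_1 and alpha_l
    remains ([Hl0_span], [Hl1_span], [Hl_ge2_span], [Hl_neg]). Finite support then gives [H1_span].
    As for brackets, omega1 and omega2 are diagonal, so bracketing with them multiplies by
    differences of eigenvalues, and the alpha_l are commuting shifts. *)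

Section Derivations.
Variable k : fieldType.
Implicit Types (f g : m0 k -> m0 k).

Lemma derivation_eq f g : derivation f -> derivation g ->
  f (e 1%N) = g (e 1%N) -> f (e 2%N) = g (e 2%N) -> f = g.
Proof.
move=> [lf df] [lg dg] fg1 fg2; apply: lin_ext => // -[|[|i]] // _.
elim: i => [|i IH] //.
(* Every later basis vector is [e_1, .] of the preceding one. *)
by rewrite -(@br_e1 k i.+2) // df dg fg1 IH.
Qed.

(** By the Jacobi identity ad x is itself a derivation, so comparing it with [d - d'] on the two
    generators suffices. *)
Lemma cls_eq_basis (l : int) (d d' : Der k l) (x : m0 k) :
  d (e 1%N) - d' (e 1%N) = br x (e 1%N) ->
  d (e 2%N) - d' (e 2%N) = br x (e 2%N) -> cls d = cls d'.
Proof.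
move=> dd1 dd2; apply/cls_eqP/innP; exists x.
have /derP[dd _] := derW (d - d').
apply: (derivation_eq dd (br_jacobi x)).
  exact: etrans (DerBE d d' _) dd1.
exact: etrans (DerBE d d' _) dd2.
Qed.

Lemma cls_eq_basis0 (l : int) (d d' : Der k l) :
  d (e 1%N) = d' (e 1%N) -> d (e 2%N) = d' (e 2%N) -> cls d = cls d'.
Proof.
move=> dd1 dd2; apply: (@cls_eq_basis _ _ _ 0); rewrite ?dd1 ?dd2 subrr.
  by rewrite (lin0 (br_linear_l _)).
by rewrite (lin0 (br_linear_l _)).
Qed.

Lemma DerZE (l : int) (a : k) (d : Der k l) x : (a *: d) x = a *: d x.
Proof. by []. Qed.

(** * Values of the generators on the basis *)

Lemma br_e_1 (j : nat) : (2 <= j)%N -> br (e j) (e 1%N) = - e (k := k) j.+1.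
Proof. by move=> j2; rewrite br_anti br_e1. Qed.

Lemma omega1_e1 : omega1 (e 1%N) = e (k := k) 1%N.
Proof. by rewrite /= /omega1_fun lext_e. Qed.
Lemma omega1_e (i : nat) : (2 <= i)%N -> omega1 (e i) = (i - 2)%:R *: e (k := k) i.
Proof. by case: i => [|[|i]] // _; rewrite /= /omega1_fun lext_e. Qed.
Lemma omega2_e1 : omega2 (e 1%N) = 0 :> m0 k.
Proof. by rewrite /= /omega2_fun lext_e. Qed.
Lemma omega2_e (i : nat) : (2 <= i)%N -> omega2 (e i) = e (k := k) i.
Proof. by case: i => [|[|i]] // _; rewrite /= /omega2_fun lext_e. Qed.
Lemma gamma_e1 (c : k) : gamma c (e 1%N) = c *: e 2%N.
Proof. by rewrite /= /gamma_fun lext_e. Qed.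
Lemma gamma_e (c : k) (i : nat) : (2 <= i)%N -> gamma c (e i) = 0.
Proof. by case: i => [|[|i]] // _; rewrite /= /gamma_fun lext_e. Qed.
Lemma alpha_e1 (b : k) (l : nat) : alpha b l (e 1%N) = 0.
Proof. by rewrite /= /alpha_fun lext_e. Qed.
Lemma alpha_e (b : k) (l i : nat) : (2 <= i)%N -> alpha b l (e i) = b *: e (i + l)%N.
Proof. by case: i => [|[|i]] // _; rewrite /= /alpha_fun lext_e. Qed.

Lemma commE (l m n : int) (lmn : l + m = n) (a : Der k l) (b : Der k m) x :
  comm lmn a b x = a (b x) - b (a x).
Proof. by []. Qed.

Lemma DerZ (l : int) (d : Der k l) a x : d (a *: x) = a *: d x.
Proof. by have /derP[[ld _] _] := derW d; exact: linZ ld a x. Qed.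

Lemma Der0 (l : int) (d : Der k l) : d 0 = 0.
Proof. by have /derP[[ld _] _] := derW d; exact: lin0. Qed.

(** * Cohomology in each weight *)

Lemma Hl0_span (h : Hl k 0) :
  exists p q : k, h = p *: cls omega1 + q *: cls omega2.
Proof.
have [d ->] := cls_surj h; have /derP[_ [a da]] := derW d.
(* On (e_1, e_2), omega1 takes the values (e_1, 0) and omega2 the values (0, e_2). *)
exists (a 1%N), (a 2%N); rewrite -!clsZ -clsD.
apply: cls_eq_basis0; rewrite DerDE !DerZE da // addr0.
  by rewrite omega1_e1 omega2_e1 scaler0 addr0.
by rewrite omega1_e // omega2_e // scale0r scaler0 add0r.
Qed.

Lemma Hl1_span (c : k) (h : Hl k 1) : c != 0 ->
  exists r : k, h = r *: cls (gamma c).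
Proof.
move=> c0; have [d ->] := cls_surj h; have /derP[_ [a da]] := derW d.
exists (a 1%N / c); rewrite -clsZ.
(* ad e_1 kills e_1 and sends e_2 to e_3, so it absorbs the value on e_2, where gamma vanishes. *)
apply: (@cls_eq_basis _ _ _ (a 2%N *: e 1%N));
  rewrite (linZ (br_linear_l _)) DerZE da //.
  by rewrite gamma_e1 scalerA divfK // subrr br_e // scaler0.
by rewrite gamma_e // scaler0 subr0 br_e1.
Qed.

Lemma Hl_ge2_span (b : k) (l : nat) (h : Hl k l) : (2 <= l)%N -> b != 0 ->
  exists s : k, h = s *: cls (alpha b l).
Proof.
move=> l2 b0; have [d ->] := cls_surj h; have /derP[_ [a da]] := derW d.
exists (a 2%N / b); rewrite -clsZ.
(* ad e_l sends e_1 to - e_(l+1) and kills e_2, so it absorbs the value on e_1, where alpha_l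
   vanishes. *)
apply: (@cls_eq_basis _ _ _ (- a 1%N *: e l));
  rewrite (linZ (br_linear_l _)) DerZE da //.
  by rewrite alpha_e1 scaler0 subr0 br_e_1 // scaleNr scalerN opprK.
by rewrite alpha_e // scalerA divfK // -PoszD subrr br_e2 ?scaler0.
Qed.

Lemma e_neq0 (n : nat) : e (k := k) n.+1 != 0.
Proof.
apply/eqP => /(congr1 (fun x => x@_n)).
by rewrite /e mcoeffUU mcoeff0 => /eqP; rewrite oner_eq0.
Qed.

Lemma e_le0 (s : int) : s <= 0 -> e (k := k) s = 0.
Proof. by case: s => [[|n]|n]. Qed.

Lemma Hl_neg (n : nat) (h : Hl k (Negz n)) : h = 0.
Proof.
have [d ->] := cls_surj h; have /derP[[ld dd] [a da]] := derW d.
have d1 : d (e 1%N) = 0 by rewrite da // e_le0 ?scaler0 //; lia.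
rewrite -(raddf0 (@cls k (Negz n))); apply: cls_eq_basis0; rewrite ?d1 //.
rewrite -[RHS]/(0 : m0 k).
(* [Negz n] is -(n+1): in weight -2 and below, e_2 is also sent to an index <= 0, so only weight -1
   needs an argument. *)
case: n h d ld dd da d1 => [|n] h d ld dd da d1; last first.
  by rewrite da // e_le0 ?scaler0 //; lia.
(* the value a_2 e_1 is excluded by 0 = d [e_2, e_3] = a_2 [e_1, e_3] = a_2 e_4 *)
have d2 : d (e 2%N) = a 2%N *: e 1%N by rewrite da.
have d3 : d (e 3%N) = 0.
  rewrite -(@br_e1 k 2) // dd d1 d2 (lin0 (br_linear_l _)) add0r.
  by rewrite (linZ (br_linear_r _)) br_e // scaler0.
have := dd (e 2%N) (e 3%N); rewrite br_e2 // Der0 d2 d3 (lin0 (br_linear_r _)).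
rewrite addr0 (linZ (br_linear_l _)) br_e1 // => /esym/eqP.
by rewrite scaler_eq0 (negPf (e_neq0 _)) orbF => /eqP->; rewrite scale0r.
Qed.

(** * Passage to the direct sum *)

Lemma H1_eq (x y : H1 k) : (forall l, x l = y l) -> x = y.
Proof. by move=> xy; apply/val_inj/functional_extensionality_dep. Qed.

Lemma componentD (x y : H1 k) l : (x + y) l = x l + y l.
Proof. by []. Qed.

Lemma componentZ (a : k) (x : H1 k) l : (a *: x) l = a *: x l.
Proof. by []. Qed.

Lemma component_sum (r : seq nat) (F : nat -> H1 k) l :
  (\sum_(i <- r) F i) l = \sum_(i <- r) F i l.
Proof. by apply: (big_morph (fun x : H1 k => x l)). Qed.

Lemma H1_classE (l : int) (d : Der k l) : H1_class d l = cls d.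
Proof. exact: single_famE. Qed.

Lemma H1_class_out (l m : int) (d : Der k l) : l != m -> H1_class d m = 0.
Proof. exact: single_fam0. Qed.

Lemma H1_classZ (l : int) (a : k) (d : Der k l) :
  H1_class (a *: d) = a *: H1_class d.
Proof.
apply: H1_eq => m; rewrite componentZ; have [<-|lm] := eqVneq l m.
  by rewrite !H1_classE clsZ.
by rewrite !H1_class_out // scaler0.
Qed.

Lemma H1_class_eq (l : int) (d d' : Der k l) :
  cls d = cls d' -> H1_class d = H1_class d'.
Proof. by rewrite /H1_class => ->. Qed.

Lemma H1_class_eq0 (l : int) (d : Der k l) : cls d = 0 -> H1_class d = 0.
Proof.
by move=> d0; rewrite -[RHS](scale0r (H1_class d)) -H1_classZ; apply: H1_class_eq;
  rewrite clsZ d0 scale0r.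
Qed.

Lemma H1_bounded (x : H1 k) :
  exists n : nat, forall l : nat, (n <= l)%N -> x l = 0.
Proof.
have /fsuppP/finite_fsetP[S xS] := H1W x.
(* This bound exceeds the absolute value of every weight in the support. *)
exists (\max_(i <- S) `|i|%N).+1 => l nl; apply: contrapT => xl.
have lS : Posz l \in S by have : [set` S]%classic (Posz l) by rewrite -xS.
by have := @leq_bigmax_seq _ (enum_fset S) predT (fun i : int => `|i|%N) _ lS isT;
  rewrite leqNgt => /negP; apply.
Qed.

Lemma H1_span (c : k) (b : nat -> k) (x : H1 k) : c != 0 ->
    (forall l : nat, (2 <= l)%N -> b l != 0) ->
  exists (p q r : k) (n : nat) (s : nat -> k),
    x = p *: H1_class omega1 + q *: H1_class omega2 + r *: H1_class (gamma c)
        + \sum_(2 <= l < n) s l *: H1_class (alpha (b l) l).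
Proof.
move=> c0 b0.
have [p [q x0]] := Hl0_span (x 0); have [r x1] := Hl1_span (x 1) c0.
have /choice[s xs] (l : nat) : exists s : k,
    (2 <= l)%N -> x l = s *: cls (alpha (b l) l).
  have [l2|] := leqP 2 l; last by exists 0.
  by have [s ?] := Hl_ge2_span (x l) l2 (b0 l l2); exists s.
have [n xn] := H1_bounded x.
exists p, q, r, n, s; apply: H1_eq => l.
rewrite !componentD !componentZ component_sum.
(* The alpha part does not contribute in weights 0, 1 and below 0. *)
have out (l' : int) : (forall i : nat, (2 <= i)%N -> Posz i != l') ->
    \sum_(2 <= i < n) (s i *: H1_class (alpha (b i) i)) l' = 0.
  move=> il; rewrite big_nat big1 // => i /andP[i2 _].
  by rewrite componentZ H1_class_out ?scaler0 // il.
case: l => [[|[|l]]|l].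
- rewrite out => [|[]//]; rewrite !H1_classE x0.
  by rewrite [H1_class (gamma c) _]H1_class_out // scaler0 !addr0.
- rewrite out => [|[|[]]//]; rewrite H1_classE x1.
  by rewrite !H1_class_out // !scaler0 !add0r addr0.
- rewrite !H1_class_out // !scaler0 !add0r.
  have [ln|nl] := ltnP l.+2 n; last first.
    rewrite xn // big_nat big1 // => i /andP[_ i_n].
    by rewrite componentZ H1_class_out ?scaler0 //; apply/eqP => -[]; lia.
  rewrite (bigD1_seq l.+2) ?iota_uniq ?mem_index_iota //.
  rewrite componentZ H1_classE xs // big1 => [|i il]; first exact/esym/addr0.
  by rewrite componentZ H1_class_out ?scaler0 //; apply: contraNneq il => -[->].
- rewrite out => [|[]//]; rewrite !H1_class_out // !scaler0 !addr0.
  exact: Hl_neg.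
Qed.

(** * Bracket relations *)

Lemma H1_br_omega1_omega2 : H1_br (H1_class (@omega1 k)) (H1_class omega2) = 0.
Proof.
rewrite (H1_brE (addr0 0)); apply: H1_class_eq0.
rewrite -(raddf0 (@cls k 0)); apply: cls_eq_basis0; rewrite commE -[RHS]/(0 : m0 k).
  by rewrite omega2_e1 omega1_e1 omega2_e1 Der0 subrr.
by rewrite omega2_e // omega1_e // subnn scale0r Der0 subrr.
Qed.

(** gamma maps e_1, of omega1-eigenvalue 1, to a multiple of e_2, of eigenvalue 0; the degree is 0 -
    1. *)
Lemma H1_br_omega1_gamma (c : k) :
  H1_br (H1_class omega1) (H1_class (gamma c)) = - H1_class (gamma c).
Proof.
rewrite (H1_brE (add0r 1)) -scaleN1r -H1_classZ.
apply/H1_class_eq/cls_eq_basis0; rewrite commE DerZE.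
  by rewrite omega1_e1 gamma_e1 DerZ omega1_e // scale0r scaler0 sub0r scaleN1r.
by rewrite omega1_e // gamma_e // DerZ gamma_e // Der0 !scaler0 subrr.
Qed.

Lemma H1_br_omega2_gamma (c : k) :
  H1_br (H1_class omega2) (H1_class (gamma c)) = H1_class (gamma c).
Proof.
rewrite (H1_brE (add0r 1)); apply/H1_class_eq/cls_eq_basis0; rewrite commE.
  by rewrite omega2_e1 gamma_e1 DerZ omega2_e // Der0 subr0.
by rewrite omega2_e // gamma_e // Der0 subrr.
Qed.

Lemma H1_br_omega1_alpha (b : k) (l : nat) :
  H1_br (H1_class omega1) (H1_class (alpha b l)) = l%:R *: H1_class (alpha b l).
Proof.
rewrite (H1_brE (add0r l%:Z)) -H1_classZ.
apply/H1_class_eq/cls_eq_basis0; rewrite commE DerZE.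
  by rewrite alpha_e1 omega1_e1 alpha_e1 Der0 subrr scaler0.
(* The omega1-eigenvalues of e_2 and e_(l+2) are 0 and l. *)
rewrite alpha_e // (omega1_e (leqnn 2)) subnn scale0r Der0 subr0.
by rewrite DerZ omega1_e // addKn !scalerA mulrC.
Qed.

Lemma H1_br_omega2_alpha (b : k) (l : nat) :
  H1_br (H1_class omega2) (H1_class (alpha b l)) = 0.
Proof.
rewrite (H1_brE (add0r l%:Z)); apply: H1_class_eq0.
rewrite -(raddf0 (@cls k l)); apply: cls_eq_basis0; rewrite commE -[RHS]/(0 : m0 k).
  by rewrite omega2_e1 alpha_e1 !Der0 subrr.
by rewrite omega2_e // alpha_e // DerZ omega2_e // subrr.
Qed.

Lemma H1_br_alpha_gamma (b c : k) (l : nat) : (0 < l)%N ->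
  H1_br (H1_class (alpha b l)) (H1_class (gamma c)) = 0.
Proof.
move=> l0; rewrite (H1_brE (erefl (l%:Z + 1))); apply: H1_class_eq0.
rewrite -(raddf0 (@cls k _)).
(* The commutator sends e_1 to c b e_(l+2) and e_2 to 0, exactly as ad of - c b e_(l+1) does; l > 0
   makes e_(l+1) commute with e_2. *)
apply: (@cls_eq_basis _ _ _ (- (c * b) *: e l.+1));
  rewrite commE -[X in _ - X = _]/(0 : m0 k) subr0 (linZ (br_linear_l _)).
  rewrite alpha_e1 Der0 subr0 gamma_e1 DerZ alpha_e // scalerA br_e_1 //.
  by rewrite scaleNr scalerN opprK.
rewrite alpha_e // gamma_e // DerZ gamma_e ?leq_addr // Der0 scaler0 subr0.
by rewrite br_e2 // scaler0.
Qed.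

Lemma H1_br_alpha_alpha (b b' : k) (l m : nat) :
  H1_br (H1_class (alpha b l)) (H1_class (alpha b' m)) = 0.
Proof.
rewrite (H1_brE (erefl (l%:Z + m%:Z))); apply: H1_class_eq0.
rewrite -(raddf0 (@cls k _)); apply: cls_eq_basis0; rewrite commE -[RHS]/(0 : m0 k).
  by rewrite !alpha_e1 !Der0 subrr.
rewrite !alpha_e // !DerZ !alpha_e ?leq_addr // !scalerA mulrC addnAC.
exact: subrr.
Qed.

End Derivations.

Theorem theorem3 (k : fieldType) (char0 : [pchar k] =i pred0)
    (c : k) (c_neq0 : c != 0)
    (b : nat -> k) (b_neq0 : forall l : nat, (2 <= l)%N -> b l != 0) :
  let w1 : H1 k := H1_class omega1 in
  let w2 : H1 k := H1_class omega2 in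
  let g : H1 k := H1_class (gamma c) in
  let al (l : nat) : H1 k := H1_class (alpha (b l) l) in
  (forall x : H1 k, exists (p q r : k) (n : nat) (s : nat -> k),
      x = p *: w1 + q *: w2 + r *: g + \sum_(2 <= l < n) s l *: al l)
  /\ H1_br w1 w2 = 0
  /\ H1_br w1 g = - g
  /\ H1_br w2 g = g
  /\ forall l m : nat, (2 <= l)%N -> (2 <= m)%N ->
      [/\ H1_br w1 (al l) = l%:R *: al l,
          H1_br w2 (al l) = 0,
          H1_br (al l) g = 0
        & H1_br (al l) (al m) = 0].
Proof.
move=> w1 w2 g al; split; first by move=> x; exact: H1_span.
split; first exact: H1_br_omega1_omega2.
split; first exact: H1_br_omega1_gamma.
split; first exact: H1_br_omega2_gamma.
move=> l m l2 _; split.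
- exact: H1_br_omega1_alpha.
- exact: H1_br_omega2_alpha.
- exact/H1_br_alpha_gamma/ltnW.
- exact: H1_br_alpha_alpha.
Qed.
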